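(* The following hold. (i) Let $\mathcal P=\{P_\theta\}_{\theta\in\Theta}$ be a univariate canonical exponential family (so $\Theta\subset\mathbb R$), and let $Z\sim P_{\theta^\star}$ for some $\theta^\star\in\Theta$. Then $$\mathbf E\log\frac{\sup_{\theta\in\Theta}p_\theta(Z)}{p_{\theta^\star}(Z)}\le 1+\log 2\quad\text{and}\quad \mathbf P\Big(\log\frac{\sup_{\theta\in\Theta}p_\theta(Z)}{p_{\theta^\star}(Z)}\le\log\frac2\delta\Big)\ge 1-\delta\quad\text{for all }\delta\in(0,1).$$ (ii) Let $\mathcal P=\{P_\beta\}_{\beta\in\mathcal B}$ be a univariate canonical generalized linear model (so $d=1$ and $\mathcal B\subset\mathbb R$), and let $Y\sim P_{\beta^\star}$ for some $\beta^\star\in\mathcal B$. Then $$\mathbf E\log\frac{\sup_{\beta\in\mathcal B}p_\beta(Y)}{p_{\beta^\star}(Y)}\le 1+\log 2\quad\text{and}\quad \mathbf P\Big(\log\frac{\sup_{\beta\in\mathcal B}p_\beta(Y)}{p_{\beta^\star}(Y)}\le\log\frac2\delta\Big)\ge 1-\delta\quad\text{for all }\delta\in(0,1).$$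
   Context: Canonical exponential family: a family $\{P_\theta\}_{\theta\in\Theta}$ of probability measures dominated by a $\sigma$-finite measure $\mu$ on $\mathbb R^n$, with fixed versions of the densities $$p_\theta(z)=\frac{dP_\theta}{d\mu}(z)=\exp\{\theta^{\mathsf T}T(z)-A(\theta)\}\,h(z),\qquad z\in\mathbb R^n,\ \theta\in\Theta,$$ where $T:\mathbb R^n\to\mathbb R^k$ and $h:\mathbb R^n\to\mathbb R_+$ are measurable, $A(\theta)=\log\int_{\mathbb R^n}\exp\{\theta^{\mathsf T}T(z)\}h(z)\,d\mu(z)$, and $\Theta=\{\theta\in\mathbb R^k:A(\theta)<\infty\}$. Univariate means $k=1$. Canonical generalized linear model: a family $\{P_\beta\}_{\beta\in\mathcal B}$ of probability measures such that there exist a $\sigma$-finite measure $\mu$ on $\mathbb R^n$, covariates $x_1,\dots,x_n\in\mathbb R^d$, and measurable functions $h:\mathbb R\to\mathbb R_+$, $A:\mathbb R\to\mathbb R\cup\{+\infty\}$ with fixed density versions $$p_\beta(y)=\frac{dP_\beta}{d\mu}(y)=\prod_{i=1}^n h(y_i)\prod_{i=1}^n\exp\big(y_ix_i^{\mathsf T}\beta-A(x_i^{\mathsf T}\beta)\big),\qquad y\in\mathbb R^n,\ \beta\in\mathcal B,$$ where $\mathcal B=\{\beta\in\mathbb R^d:A(x_i^{\mathsf T}\beta)<\infty\ \forall i\in[n]\}$ and the normalization $\sum_{i=1}^nA(x_i^{\mathsf T}\beta)=\log\int_{\mathbb R^n}\exp\{\sum_{i=1}^n y_ix_i^{\mathsf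 T}\beta\}\prod_{i=1}^nh(y_i)\,d\mu(y)$ holds for every $\beta\in\mathbb R^d$ (both sides possibly $+\infty$). Univariate means $d=1$. *)

(* Defs.v *)
From HB Require Import structures.
From mathcomp Require Import all_boot all_order all_algebra.
From mathcomp Require Import all_classical all_reals all_analysis.
From mathcomp Require Import measurable_realfun.

Set Implicit Arguments.
Unset Strict Implicit.
Unset Printing Implicit Defensive.

Import Order.TTheory GRing.Theory Num.Theory.

Local Open Scope classical_set_scope.
Local Open Scope ring_scope.

(* R^n is [n.-tuple R], which carries the product (Borel) sigma-algebra. *)

Definition dotp (R : realType) (k : nat) (u v : k.-tuple R) : R :=
  \sum_(i < k) tnth u i * tnth v i.

(* The supremum may be +oo, so the logarithm is taken in [\bar R]
   (lne +oo = +oo). Where [p t0 z = 0], which happens only on a null set of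
   the law with density [p t0], the value follows the library's conventions
   for [/] and [lne] and is irrelevant. *)
Definition log_lr (R : realType) (I X : Type) (p : I -> X -> \bar R)
    (D : set I) (t0 : I) (z : X) : \bar R :=
  lne (ereal_sup [set p t z | t in D] / p t0 z)%E.

Section exponential_family.
Context (R : realType) (n k : nat).
Variables (mu : {sigma_finite_measure set (n.-tuple R) -> \bar R})
  (T : n.-tuple R -> k.-tuple R) (h : n.-tuple R -> R).
Local Open Scope ereal_scope.

Definition ef_A (theta : k.-tuple R) : \bar R :=
  lne (\int[mu]_z (expR (dotp theta (T z)) * h z)%:E).

Definition ef_Theta : set (k.-tuple R) := [set theta | ef_A theta < +oo].

Definition ef_density (theta : k.-tuple R) (z : n.-tuple R) : \bar R :=
  expeR ((dotp theta (T z))%:E - ef_A theta) * (h z)%:E.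

(* The family is indexed by all of R^k for convenience; only its members with
   parameter in [ef_Theta] are constrained. *)
Record canonical_exponential_family
    (P : k.-tuple R -> probability (n.-tuple R) R) : Prop := {
  ef_measurable_T : measurable_fun [set: n.-tuple R] T ;
  ef_measurable_h : measurable_fun [set: n.-tuple R] h ;
  ef_h_ge0 : forall z, (0 <= h z)%R ;
  ef_densityP : forall theta, ef_Theta theta ->
    forall B : set (n.-tuple R), measurable B ->
      P theta B = \int[mu]_(z in B) ef_density theta z }.

End exponential_family.

Section generalized_linear_model.
Context (R : realType) (n d : nat).
Variables (mu : {sigma_finite_measure set (n.-tuple R) -> \bar R})
  (x : 'I_n -> d.-tuple R) (h : R -> R) (A : R -> \bar R).
Local Open Scope ereal_scope.

Definition glm_B : set (d.-tuple R) :=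
  [set beta | forall i : 'I_n, A (dotp (x i) beta) < +oo].

Definition glm_density (beta : d.-tuple R) (y : n.-tuple R) : \bar R :=
  (\prod_(i < n) (h (tnth y i))%:E) *
  \prod_(i < n) expeR ((tnth y i * dotp (x i) beta)%:E - A (dotp (x i) beta)).

Record canonical_glm
    (P : d.-tuple R -> probability (n.-tuple R) R) : Prop := {
  glm_measurable_h : measurable_fun [set: R] h ;
  glm_h_ge0 : forall t, (0 <= h t)%R ;
  glm_measurable_A : measurable_fun [set: R] A ;
  glm_A_gtNy : forall t, -oo < A t ;
  glm_normalization : forall beta : d.-tuple R,
    \sum_(i < n) A (dotp (x i) beta) =
    lne (\int[mu]_y (expR (\sum_(i < n) tnth y i * dotp (x i) beta) *
                     \prod_(i < n) h (tnth y i))%:E) ;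
  glm_densityP : forall beta, glm_B beta ->
    forall B : set (n.-tuple R), measurable B ->
      P beta B = \int[mu]_(y in B) glm_density beta y }.

End generalized_linear_model.

Definition has_law (R : realType) (dO dX : measure_display)
    (Omega : measurableType dO) (X : measurableType dX)
    (Pr : probability Omega R) (Z : {RV Pr >-> X}) (Q : probability X R) :
    Prop :=
  forall B : set X, measurable B -> distribution Pr Z B = Q B.

(* Main.v *)
(* Fix s >= 0. With L the log-likelihood ratio and t the (scalar) sufficient
   statistic, the event {L > s} is, up to a null set, the union over the
   parameters i of the half-lines {(c_i - c_0) t > s + a_i - a_0}. Those with
   c_i > c_0 are upper half-lines and those with c_i < c_0 are lower
   half-lines, so on each side the union is that of a countable chain and has
   probability at most the supremum of the probabilities of its members.
   Markov's inequality for the ratio p_i / p_0, of mean at most 1, bounds each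
   of these by exp(-s), hence P(L > s) <= 2 exp(-s). The tail bound is the case
   s = ln(2 / delta), and integrating the tail gives E L <= ln 2 + 1. *)
Require Import Defs.
From HB Require Import structures.
From mathcomp Require Import all_boot all_order all_algebra.
From mathcomp Require Import all_classical all_reals all_analysis.
From mathcomp Require Import measurable_realfun.
From mathcomp Require Import lra.
Import Order.TTheory GRing.Theory Num.Theory.
Local Open Scope classical_set_scope.
Local Open Scope ring_scope.

(** * Measure-theoretic tools: unions of half-lines and integration of tails *)

(** The sets are nested, so an arbitrary union equals the union along a sequence of endpoints
    tending to the infimum of [J]; continuity from below then gives the bound. The case of empty [J]
    rests on [0 <= b]. *)
Lemma measure_bigcup_upper_halfline (R : realType) (dX : measure_display)
    (X : measurableType dX) (Q : {measure set X -> \bar R}) (t : X -> R)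
    (J : set R) (b : \bar R) :
  measurable_fun setT t -> (0 <= b)%E ->
  (forall r, J r -> (Q (t @^-1` `]r, +oo[) <= b)%E) ->
  measurable (\bigcup_(r in J) t @^-1` `]r, +oo[) /\
  (Q (\bigcup_(r in J) t @^-1` `]r, +oo[) <= b)%E.
Proof.
move=> mt b0 Jb; have [J0|/set0P[r0 Jr0]] := eqVneq J set0.
  by rewrite J0 bigcup_set0 measure0; split.
have mray r : measurable (t @^-1` `]r, +oo[).
  by rewrite -[X in measurable X]setTI; exact: mt.
have [u Ju uJ] : {u : (\bar R)^nat | forall i, (EFin @` J) (u i) &
    u @ \oo --> ereal_inf (EFin @` J)}.
  by apply: ereal_inf_seq; apply/set0P; exists r0%:E; exists r0.
have /choice[v Jv] : forall i, exists r, J r /\ r%:E = u i.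
  by move=> i; have [r Jr ru] := Ju i; exists r.
pose F i := t @^-1` `]v i, +oo[.
(* If [t z] were in no [F i], then [t z <= v i] for all [i], and in the limit [t z] would be at most
   the infimum of [J], although it exceeds some [r] in [J]. *)
have JF : \bigcup_(r in J) t @^-1` `]r, +oo[ = \bigcup_i F i.
  apply/seteqP; split=> z [r Jr]; rewrite /F/= in_itv/= andbT => rz; last first.
    by exists (v r); [have [] := Jv r | rewrite /= in_itv/= andbT].
  have : (ereal_inf (EFin @` J) < (t z)%:E)%E.
    by apply/ereal_inf_ltP; exists r%:E; [exists r | rewrite lte_fin].
  move=> inft; apply: contrapT => tF; move: inft; apply/negP; rewrite -leNgt.
  rewrite -(cvg_lim _ uJ)//; apply: lime_ge; first by apply/cvg_ex; eexists; exact: uJ.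
  apply: nearW => n; have [_ <-] := Jv n; rewrite lee_fin leNgt.
  by apply/negP => vt; apply: tF; exists n => //; rewrite /F/= in_itv/= andbT.
(* The sequence [v] need not be monotone. Its finite unions increase, and each is again a single
   half-line with endpoint in [J], to which the hypothesis applies. *)
pose G n := \big[setU/set0]_(i < n.+1) F i.
have GJ n : exists2 r, J r & G n = t @^-1` `]r, +oo[.
  elim: n => [|n [r Jr Gr]].
    by exists (v 0%N); [have [] := Jv 0%N | rewrite /G big_ord1].
  rewrite /G big_ord_recr/= -/(G n) Gr /F/=.
  have [rv|vr] := leP r (v n.+1).
    exists r => //; apply/setUidl => z /=; rewrite !in_itv/= !andbT.
    exact: le_lt_trans.
  exists (v n.+1); first by have [] := Jv n.+1.
  apply/setUidr => z /=; rewrite !in_itv/= !andbT.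
  exact/lt_trans.
have mF : measurable (\bigcup_i F i) by apply: bigcup_measurable => i _; exact: mray.
split; rewrite JF//.
have QG : (Q \o G) @ \oo --> Q (\bigcup_i F i).
  rewrite -bigcup_bigsetU_bigcup; apply: nondecreasing_cvg_mu.
  - by move=> n; have [r _ ->] := GJ n.
  - by rewrite bigcup_bigsetU_bigcup.
  - by apply/nondecreasing_seqP => n; rewrite subsetEset => z Gz; rewrite /G big_ord_recr/=; left.
rewrite -(cvg_lim _ QG)//; apply: lime_le; first by apply/cvg_ex; eexists; exact: QG.
by apply: nearW => n /=; have [r Jr ->] := GJ n; exact: Jb.
Qed.

(** The mean is the integral of the tail over [s >= 0], and the tail is dominated by the exponential
    density of rate 1, whose total mass is 1. *)
Lemma expectation_le1_of_tail (R : realType) (dO : measure_display)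
    (Omega : measurableType dO) (Pr : probability Omega R)
    (f : Omega -> R) :
  measurable_fun setT f -> (forall w, 0 <= f w) ->
  (forall s, 0 <= s -> (Pr [set w | (s < f w)%R] <= (expR (- s))%:E)%E) ->
  (\int[Pr]_w (f w)%:E <= 1)%E.
Proof.
move=> mf f0 tail.
pose X : {RV Pr >-> R} := HB.pack f (isMeasurableFun.Build _ _ _ _ f mf).
have <- : ('E_Pr[X] = \int[Pr]_w (f w)%:E)%E by rewrite expectation_def.
rewrite ge0_expectation_ccdf//.
have mE : measurable_fun setT (EFin \o exponential_pdf (1 : R)).
  by apply/measurable_EFinP; exact: measurable_exponential_pdf.
have E0 x : (0 <= (exponential_pdf (1 : R) x)%:E)%E.
  by rewrite lee_fin exponential_pdf_ge0.
rewrite -(@integral_exponential_pdf R 1)//.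
apply: (@le_trans _ _
  (\int[lebesgue_measure]_(x in `[0%R, +oo[) (exponential_pdf 1 x)%:E)%E).
  apply: ge0_le_integral => //.
  - exact: measurable_funS (ccdf_measurable X).
  - exact: measurable_funS mE.
  - move=> s; rewrite /= in_itv/= andbT => s0.
    rewrite exponential_pdfE// mul1r mulN1r.
    apply: le_trans (tail _ s0); rewrite le_eqVlt; apply/orP; left; apply/eqP.
    rewrite /ccdf /distribution/= /pushforward; congr (Pr _).
    by apply/seteqP; split=> w; rewrite /= in_itv/= andbT.
exact: ge0_subset_integral.
Qed.

(** Starting the tail at level [ln c] absorbs the factor [c]: the overshoot of [f] above [ln c] has
    tail at most [expR (- s)], hence mean at most 1. *)
Lemma integral_le_of_tail (R : realType) (dO : measure_display)
    (Omega : measurableType dO) (Pr : probability Omega R)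
    (f : Omega -> \bar R) (c : R) :
  1 <= c ->
  (forall s, 0 <= s -> measurable [set w | (s%:E < f w)%E]) ->
  (forall s, 0 <= s -> (Pr [set w | s%:E < f w] <= (c * expR (- s))%:E)%E) ->
  (\int[Pr]_w f w <= (1 + ln c)%:E)%E.
Proof.
move=> c1 mf tail.
have c0 : 0 < c by exact: lt_le_trans c1.
have lnc0 : 0 <= ln c by rewrite ln_ge0.
(* Superlevel sets of [f] are known to be measurable only at nonnegative levels. Truncating from
   below at [a >= 0] makes the lower levels trivial. *)
have mmax a : 0 <= a -> measurable_fun setT (fun w => maxe (f w) a%:E).
  move=> a0; apply: (measurability _ (ErealGenOInfty.measurableE R)).
  move=> // _ [_ [y ->] <-]; rewrite setTI.
  have [ya|ay] := ltP y a.
    rewrite [X in measurable X](_ : _ = setT)//; apply/seteqP; split=> // w _.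
    by rewrite /= in_itv/= andbT lt_max lte_fin ya orbT.
  rewrite [X in measurable X](_ : _ = [set w | (y%:E < f w)%E]).
    by apply: mf; exact: le_trans ay.
  apply/seteqP; split=> w; rewrite /= in_itv/= andbT lt_max lte_fin.
    by rewrite [X in _ || X]ltNge ay orbF.
  by move=> ->.
pose g w := maxe (f w) (ln c)%:E.
have mg : measurable_fun setT g by exact: mmax.
have g_ge w : ((ln c)%:E <= g w)%E by rewrite /g le_max lexx orbT.
have g0 w : (0 <= g w)%E by rewrite (le_trans _ (g_ge w))// lee_fin.
(* The overshoot (f - ln c)^+, except that [fine] makes it 0 on the null set
   where f = +oo. *)
pose X w := fine (g w - (ln c)%:E).
have mX : measurable_fun setT X.
  apply: (@measurableT_comp _ _ _ _ _ _ fine).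
    exact: fine_measurable.
  exact: emeasurable_funB mg (measurable_cst _).
have X0 w : 0 <= X w by rewrite /X fine_ge0// sube_ge0.
have gX w : (g w < +oo)%E -> g w = (X w + ln c)%:E.
  move=> gy; have gfin : g w \is a fin_num.
    by rewrite fin_numE gt_eqF ?lt_eqF// (lt_le_trans _ (g_ge w))// ltNyr.
  by rewrite /X fineB// subrK fineK.
have EX : (\int[Pr]_w (X w)%:E <= 1)%E.
  apply: expectation_le1_of_tail => // s s0.
  have -> : expR (- s) = c * expR (- (s + ln c)).
    by rewrite opprD expRD [expR (- ln c)]expRN lnK ?posrE// mulrCA divff ?mulr1// gt_eqF.
  apply: le_trans (tail _ (addr_ge0 s0 lnc0)).
  apply: le_measure; rewrite ?inE.
  - rewrite -[X in measurable X]setTI.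
    rewrite [X in measurable (_ `&` X)](_ : _ = X @^-1` `]s, +oo[); first exact: mX.
    by apply/seteqP; split=> w; rewrite /= in_itv/= andbT.
  - by apply: mf; exact: addr_ge0.
  - move=> w /= sX.
    have [gy|] := ltP (g w) +oo%E.
      have := gX _ gy; rewrite /g; have [_ [fc]|_ ->] := leP (f w) (ln c)%:E.
        have XO : X w = 0 by lra.
        by move: sX; rewrite XO ltNge s0.
      by rewrite lte_fin ltrD2r.
    rewrite leye_eq /g /maxe; case: ifPn => // _ /eqP ->.
    by rewrite ltry.
have mgy : measurable [set w | g w = +oo%E].
  by rewrite -[X in measurable X]setTI; exact: (mg measurableT [set +oo%E]).
have gy0 : Pr [set w | g w = +oo%E] = 0%E.
  apply/eqP; rewrite eq_le measure_ge0 andbT leNgt; apply/negP => Py.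
  have Pfin : Pr [set w | g w = +oo%E] \is a fin_num by exact: fin_num_measure.
  pose p := fine (Pr [set w | g w = +oo%E]).
  have p0 : 0 < p by rewrite fine_gt0// Py ltey_eq Pfin.
  (* At the level [c / p], the inequality [1 + u <= expR u] gives [p * expR (c / p) >= p + c > c],
     which contradicts the tail bound. *)
  have s0 : 0 <= c / p by rewrite divr_ge0// ltW.
  have : (p%:E <= (c * expR (- (c / p)))%:E)%E.
    rewrite /p fineK//; apply: le_trans (tail _ s0).
    apply: le_measure; rewrite ?inE//; first exact: mf.
    by move=> w /=; rewrite /g /maxe; case: ifPn => // _ ->; rewrite ltry.
  rewrite lee_fin expRN leNgt ltr_pdivrMr ?expR_gt0//; apply/negP/negPn.
  rewrite (@lt_le_trans _ _ (p * (1 + c / p)))//.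
    by rewrite mulrDr mulr1 mulrCA divff ?gt_eqF// mulr1 ltrDr.
  by rewrite ler_pM2l// expR_ge1Dx.
(* The negative part of [f] is dropped, and the positive part lies below [g] because [ln c >= 0]. *)
apply: (@le_trans _ _ (\int[Pr]_w g w)%E).
  rewrite integralE; apply: (@le_trans _ _ (\int[Pr]_w (f^\+ w)%E)%E).
    by rewrite geeDl// oppe_le0 integral_ge0.
  apply: ge0_le_integral => //.
    by rewrite unlock; exact: (mmax 0 (lexx 0)).
  by move=> w _; rewrite unlock /g ge_max le_max lexx /= g0.
have mXe : measurable_fun setT (EFin \o X) by exact/measurable_EFinP.
apply: (@le_trans _ _ (\int[Pr]_w ((X w)%:E + (ln c)%:E))%E).
  apply: ae_ge0_le_integral => //.
  - by move=> w _; rewrite adde_ge0// lee_fin.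
  - exact: emeasurable_funD mXe (measurable_cst _).
  - exists [set w | g w = +oo%E]; split => //.
    move=> w /= /not_implyP[_]; apply: contra_notP => gNy.
    by rewrite -EFinD gX ?lexx// lt_neqAle leey andbT; exact/eqP.
rewrite ge0_integralD//=.
- have -> : (\int[Pr]_w (ln c)%:E = (ln c)%:E)%E.
    by rewrite -[RHS]mule1 -(probability_setT Pr) -integral_cst.
  by rewrite EFinD leeD2r.
- by move=> w _; rewrite lee_fin.
Qed.

(** * Tail bound for densities [expR (c i * t z - a i) * H z], a form common to both families *)

Section chernoff.
Context (R : realType) (dX : measure_display) (X : measurableType dX) (I : Type).
Variables (mu : {measure set X -> \bar R}) (D : set I) (i0 : I).
Variables (c a : I -> R) (t H : X -> R) (p : I -> X -> \bar R).
Variable P : I -> probability X R.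
Hypotheses (Di0 : D i0) (mt : measurable_fun setT t) (mH : measurable_fun setT H).
Hypothesis H0 : forall z, 0 <= H z.
Hypothesis pE : forall i z, D i -> p i z = (expR (c i * t z - a i) * H z)%:E.
Hypothesis Pp : forall i B, D i -> measurable B ->
  P i B = (\int[mu]_(z in B) p i z)%E.

Let p_ge0 i z : D i -> (0 <= p i z)%E.
Proof. by move=> Di; rewrite pE// lee_fin mulr_ge0// expR_ge0. Qed.

Let measurable_p i : D i -> measurable_fun setT (p i).
Proof.
move=> Di; rewrite (_ : p i = fun z => (expR (c i * t z - a i) * H z)%:E).
  apply/measurable_EFinP; apply: measurable_funM => //.
  apply: measurableT_comp => //; apply: measurable_funB => //.
  exact: measurable_funM.
by apply/funext => z; rewrite pE.
Qed.

(** Where [H z > 0] this factor cancels, and a supremum strictly exceeds a level exactly when some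
    member does. Where [H z = 0] the ratio is 0 by convention and its logarithm is [-oo]. *)
Lemma lt_log_lrE s z :
  (s%:E < log_lr p D i0 z)%E <->
  0 < H z /\ exists2 i, D i & s < (c i - c i0) * t z - (a i - a i0).
Proof.
have ltE i : D i -> 0 < H z ->
    ((expR s)%:E * p i0 z < p i z)%E = (s < (c i - c i0) * t z - (a i - a i0)).
  move=> Di Hz; rewrite !pE// -EFinM lte_fin mulrA -expRD ltr_pM2r// ltr_expR.
  by apply/idP/idP; lra.
have p0pos : 0 < H z -> 0 < expR (c i0 * t z - a i0) * H z.
  by move=> Hz; rewrite mulr_gt0// expR_gt0.
have sup0 : (0 <= ereal_sup [set p i z | i in D])%E.
  by apply: (le_trans (p_ge0 i0 z Di0)); apply: ereal_sup_ubound; exists i0.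
have lneE x : (0 <= x)%E -> (s%:E < lne x)%E = ((expR s)%:E < x)%E.
  move=> x0; rewrite -lte_expeR lneK// in_itv/= x0 leey//.
rewrite /log_lr; split=> [|[Hz [i Di]]].
  have [Hz|] := ltP 0 (H z); last first.
    move=> Hz; have HE : H z = 0 by apply/eqP; rewrite eq_le Hz H0.
    have -> : [set p i z | i in D] = [set 0%E].
      apply/seteqP; split=> [_ [i Di <-]|_ ->]; first by rewrite /= pE// HE mulr0.
      by exists i0 => //; rewrite pE// HE mulr0.
    by rewrite ereal_sup1 mul0e le0_lneNy// ltNge leNye.
  rewrite {1}pE// inver gt_eqF ?p0pos// lneE; last first.
    by rewrite mule_ge0// lee_fin invr_ge0 ltW// p0pos.
  rewrite lte_pdivlMr ?p0pos// -pE// => /ereal_sup_gtP[_ [i Di <-]].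
  by rewrite ltE// => h; split => //; exists i.
rewrite -ltE// => h; rewrite {1}pE// inver gt_eqF ?p0pos// lneE; last first.
  by rewrite mule_ge0// lee_fin invr_ge0 ltW// p0pos.
rewrite lte_pdivlMr ?p0pos// -pE//; apply: (lt_le_trans h).
by apply: ereal_sup_ubound; exists i.
Qed.

(** On [B] the density [p i0] is at most [expR (- s)] times [p i]; integrate over [B] and bound
    [P i B] by 1. The sign of [s] is free. *)
Let chernoff i s B : D i -> measurable B ->
  (forall z, B z -> s <= (c i - c i0) * t z - (a i - a i0)) ->
  (P i0 B <= (expR (- s))%:E)%E.
Proof.
move=> Di mB Bs; rewrite Pp// -[leRHS]mule1 -(probability_setT (P i)) Pp//.
apply: (@le_trans _ _ ((expR (- s))%:E * \int[mu]_(z in B) p i z)%E); last first.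
  rewrite lee_pmul2l ?lte_fin ?expR_gt0//; apply: ge0_subset_integral => //.
    exact: measurable_p.
  by move=> z _; exact: p_ge0.
rewrite -ge0_integralZl_EFin ?expR_ge0//; last 2 first.
- by move=> z _; exact: p_ge0.
- exact: measurable_funS (measurable_p _ Di).
apply: ge0_le_integral => //.
- by move=> z _; exact: p_ge0.
- exact: measurable_funS (measurable_p _ Di0).
- apply: measurable_funeM; exact: measurable_funS (measurable_p _ Di).
move=> z Bz; rewrite !pE// -EFinM lee_fin mulrA -expRD ler_wpM2r// ler_expR.
by have := Bs z Bz; lra.
Qed.

Lemma log_lr_tail s : 0 <= s ->
  measurable [set z | (s%:E < log_lr p D i0 z)%E] /\
  (P i0 [set z | s%:E < log_lr p D i0 z] <= (2 * expR (- s))%:E)%E.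
Proof.
move=> s0.
(* Parameters with slope [c i0] give no half-line. Comparing total masses, with [B = setT] and
   [s = a i0 - a i], shows that their constant log-ratio is at most 0, so it never exceeds
   [s >= 0]. *)
have same_slope i : D i -> c i = c i0 -> a i0 <= a i.
  move=> Di ci; have := @chernoff i (a i0 - a i) setT Di measurableT.
  rewrite ci subrr => /(_ _)/wrap[z _|]; first by rewrite mul0r sub0r opprB.
  by rewrite probability_setT lee_fin -expR0 ler_expR; lra.
pose J1 := [set r | exists i, [/\ D i, c i0 < c i &
  r = (s + a i - a i0) / (c i - c i0)]].
pose J2 := [set r | exists i, [/\ D i, c i < c i0 &
  r = (s + a i - a i0) / (c i0 - c i)]].
(* Lower half-lines in [t] are upper half-lines in [- t], which is why [J2] divides by
   [c i0 - c i]. *)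
pose Nt z := - t z.
have mNt : measurable_fun setT Nt by exact: measurable_funN.
have e0 : (0 <= (expR (- s))%:E)%E by rewrite lee_fin expR_ge0.
have mray (u : X -> R) r : measurable_fun setT u -> measurable (u @^-1` `]r, +oo[).
  by move=> mu'; rewrite -[X in measurable X]setTI; exact: mu'.
have [mU1 QU1] : measurable (\bigcup_(r in J1) t @^-1` `]r, +oo[) /\
    (P i0 (\bigcup_(r in J1) t @^-1` `]r, +oo[) <= (expR (- s))%:E)%E.
  apply: measure_bigcup_upper_halfline => // _ [i [Di ci ->]].
  apply: (@chernoff i) => //; first exact: mray.
  move=> z; rewrite /= in_itv/= andbT ltr_pdivrMr ?subr_gt0//; lra.
have [mU2 QU2] : measurable (\bigcup_(r in J2) Nt @^-1` `]r, +oo[) /\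
    (P i0 (\bigcup_(r in J2) Nt @^-1` `]r, +oo[) <= (expR (- s))%:E)%E.
  apply: measure_bigcup_upper_halfline => // _ [i [Di ci ->]].
  apply: (@chernoff i) => //; first exact: mray.
  move=> z; rewrite /= in_itv/= andbT /Nt ltr_pdivrMr ?subr_gt0//; lra.
set U1 := \bigcup_(r in J1) _ in mU1 QU1; set U2 := \bigcup_(r in J2) _ in mU2 QU2.
(* This equality is exact, so it also yields measurability of the event, although the supremum may
   run over uncountably many parameters. *)
have LE : [set z | (s%:E < log_lr p D i0 z)%E] = H @^-1` `]0, +oo[ `&` (U1 `|` U2).
  apply/seteqP; split=> [z /= /lt_log_lrE[Hz [i Di si]]|z /= [Hz UU]].
    split; first by rewrite /= in_itv/= andbT.
    have [ci|ci|ci] := ltgtP (c i) (c i0).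
    - right; exists ((s + a i - a i0) / (c i0 - c i)); first by exists i.
      by rewrite /= in_itv/= andbT /Nt ltr_pdivrMr ?subr_gt0//; lra.
    - left; exists ((s + a i - a i0) / (c i - c i0)); first by exists i.
      by rewrite /= in_itv/= andbT ltr_pdivrMr ?subr_gt0//; lra.
    - by have := same_slope _ Di ci; rewrite ci in si; lra.
  apply/lt_log_lrE; split; first by move: Hz; rewrite /= in_itv/= andbT.
  case: UU => -[_ [i [Di ci ->]]];
    rewrite /= in_itv/= andbT /Nt ltr_pdivrMr ?subr_gt0// => si; exists i => //; lra.
have mL : measurable [set z | (s%:E < log_lr p D i0 z)%E].
  by rewrite LE; apply: measurableI; [exact: mray | exact: measurableU].
split => //; apply: (@le_trans _ _ (P i0 (U1 `|` U2))).
  by apply: le_measure; rewrite ?inE//; [exact: measurableU | rewrite LE].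
apply: (le_trans (measureU2 _ _ _)) => //.
by rewrite mulr2n mulrDl mul1r EFinD leeD.
Qed.

Lemma log_lr_bounds (dO : measure_display) (Omega : measurableType dO)
    (Pr : probability Omega R) (Z : {RV Pr >-> X}) :
  has_law Z (P i0) ->
  (\int[Pr]_w log_lr p D i0 (Z w) <= (1 + ln 2)%:E)%E /\
  (forall delta : R, 0 < delta < 1 ->
    ((1 - delta)%:E <= Pr [set w | log_lr p D i0 (Z w) <= (ln (2 / delta))%:E])%E).
Proof.
move=> law.
have mtail s : 0 <= s -> measurable [set w | (s%:E < log_lr p D i0 (Z w))%E].
  move=> s0; rewrite -[X in measurable X]setTI.
  by apply: (measurable_funPT Z measurableT [set z | (s%:E < log_lr p D i0 z)%E]);
     exact: (log_lr_tail _ s0).1.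
have tail s : 0 <= s ->
    (Pr [set w | s%:E < log_lr p D i0 (Z w)] <= (2 * expR (- s))%:E)%E.
  by move=> s0; have [mL] := log_lr_tail _ s0; rewrite -law.
split; first by apply: integral_le_of_tail => //; rewrite ler1n.
move=> delta /andP[d0 d1]; have l0 : 0 <= ln (2 / delta).
  by rewrite ln_ge0// ler_pdivlMr// mul1r (le_trans (ltW d1))// ler1n.
rewrite (_ : [set w | _] =
    ~` [set w | ((ln (2 / delta))%:E < log_lr p D i0 (Z w))%E]); last first.
  by apply/seteqP; split=> w /=; rewrite leNgt => /negP.
rewrite probability_setC; last exact: mtail.
rewrite EFinB leeB//; apply: (le_trans (tail _ l0)).
by rewrite expRN lnK ?posrE ?divr_gt0// invf_div mulrCA divff ?mulr1.
Qed.

End chernoff.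

(** * Reduction of the two families to the common form *)

(** [ef_Theta] excludes only [+oo]; the value [-oo], the logarithm of a zero integral, is
    incompatible with [P theta] having mass 1. Finiteness allows [fine] of [ef_A] to serve as the
    real offset [a]. *)
Lemma ef_A_fin (R : realType) (n k : nat)
    (mu : {sigma_finite_measure set (n.-tuple R) -> \bar R})
    (T : n.-tuple R -> k.-tuple R) (h : n.-tuple R -> R)
    (P : k.-tuple R -> probability (n.-tuple R) R) (theta : k.-tuple R) :
  canonical_exponential_family mu T h P -> ef_Theta mu T h theta ->
  ef_A mu T h theta \is a fin_num.
Proof.
move=> [mT mh h0 dP] Dtheta; rewrite fin_numE (lt_eqF Dtheta) andbT.
apply/negP => /eqP ANy.
(* The density would be +oo * h, whose integral is 0 or +oo but not 1. *)
have := probability_setT (P theta); rewrite dP// /ef_density ANy.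
under eq_integral do rewrite /= ?addey//.
rewrite ge0_integralZl//; last 2 first.
- exact/measurable_EFinP.
- by move=> z _; rewrite lee_fin.
case: (eqVneq (\int[mu]_z (h z)%:E)%E 0%E) => [->|h_neq0].
  by rewrite mule0 => -[] /esym/eqP; rewrite oner_eq0.
by rewrite gt0_mulye// lt_neqAle eq_sym h_neq0 integral_ge0// => z _; rewrite lee_fin.
Qed.

Lemma glm_densityE (R : realType) (n d : nat)
    (x : 'I_n -> d.-tuple R) (h : R -> R) (A : R -> \bar R) (beta : d.-tuple R)
    (y : n.-tuple R) :
  (forall u, -oo < A u)%E -> glm_B x A beta ->
  glm_density x h A beta y =
    (expR (\sum_(i < n) tnth y i * dotp (x i) beta -
           \sum_(i < n) fine (A (dotp (x i) beta))) *
     \prod_(i < n) h (tnth y i))%:E.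
Proof.
move=> ANy Bbeta; rewrite /glm_density -sumrB expR_sum EFinM -!prodEFin muleC.
congr (_ * _)%E; apply: eq_bigr => i _.
have Afin : A (dotp (x i) beta) \is a fin_num.
  by rewrite fin_numE gt_eqF ?ANy// lt_eqF// Bbeta.
by rewrite -[in LHS](fineK Afin).
Qed.

Theorem corollary3p1 (R : realType) :
  (forall (n : nat) (mu : {sigma_finite_measure set (n.-tuple R) -> \bar R})
      (T : n.-tuple R -> 1.-tuple R) (h : n.-tuple R -> R)
      (P : 1.-tuple R -> probability (n.-tuple R) R),
    canonical_exponential_family mu T h P ->
    forall (theta0 : 1.-tuple R), ef_Theta mu T h theta0 ->
    forall (dO : measure_display) (Omega : measurableType dO)
      (Pr : probability Omega R) (Z : {RV Pr >-> n.-tuple R}),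
    has_law Z (P theta0) ->
    let llr := log_lr (ef_density mu T h) (ef_Theta mu T h) theta0 in
    (\int[Pr]_w llr (Z w) <= (1 + ln 2)%:E)%E /\
    (forall delta : R, 0 < delta < 1 ->
      ((1 - delta)%:E <= Pr [set w | llr (Z w) <= (ln (2 / delta))%:E])%E))
  /\
  (forall (n : nat) (mu : {sigma_finite_measure set (n.-tuple R) -> \bar R})
      (x : 'I_n -> 1.-tuple R) (h : R -> R) (A : R -> \bar R)
      (P : 1.-tuple R -> probability (n.-tuple R) R),
    canonical_glm mu x h A P ->
    forall (beta0 : 1.-tuple R), glm_B x A beta0 ->
    forall (dO : measure_display) (Omega : measurableType dO)
      (Pr : probability Omega R) (Y : {RV Pr >-> n.-tuple R}),
    has_law Y (P beta0) ->
    let llr := log_lr (glm_density x h A) (glm_B x A) beta0 in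
    (\int[Pr]_w llr (Y w) <= (1 + ln 2)%:E)%E /\
    (forall delta : R, 0 < delta < 1 ->
      ((1 - delta)%:E <= Pr [set w | llr (Y w) <= (ln (2 / delta))%:E])%E)).
Proof.
have dotp1 (u v : 1.-tuple R) : dotp u v = tnth u ord0 * tnth v ord0.
  by rewrite /dotp big_ord1.
split=> [n mu T h P efP theta0 D0|n mu x h A P glmP beta0 D0] dO Omega Pr Z law.
  have [mT mh h0 dP] := efP.
  apply: (@log_lr_bounds R _ _ _ mu _ theta0 (fun theta => tnth theta ord0)
    (fun theta => fine (ef_A mu T h theta)) (fun z => tnth (T z) ord0) h _ P) => //.
  - exact: (measurableT_comp (measurable_tnth ord0) mT).
  - move=> theta z Dtheta; have Afin := ef_A_fin _ _ _ _ _ _ _ _ efP Dtheta.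
    by rewrite /ef_density -[in LHS](fineK Afin) dotp1.
  - by move=> theta B Dtheta; exact: dP.
have [mh h0 _ ANy _ dP] := glmP.
(* For scalar covariates, the exponent is linear in [beta] with the single statistic that sums
   [y_i x_i]; the terms in [A] add up to the offset. *)
apply: (@log_lr_bounds R _ _ _ mu _ beta0 (fun beta => tnth beta ord0)
  (fun beta => \sum_(i < n) fine (A (dotp (x i) beta)))
  (fun y => \sum_(i < n) tnth y i * tnth (x i) ord0)
  (fun y => \prod_(i < n) h (tnth y i)) _ P) => //.
- apply: measurable_sum => i; apply: measurable_funM => //.
  exact: measurable_tnth.
- apply: measurable_prod => i _.
  exact: measurableT_comp mh (measurable_tnth i).
- by move=> y; apply: prodr_ge0.
- move=> beta y Dbeta; rewrite glm_densityE//; congr (expR (_ - _) * _)%:E.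
  by rewrite mulr_sumr; apply: eq_bigr => i _; rewrite dotp1 mulrA mulrC.
- by move=> beta B Dbeta; exact: dP.
Qed.
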